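(* Let $n\in\mathbb{N}$, $n\ge1$, and, for every $i\in\{1,\ldots,n\}$, let $L_i$ and $M_i$ be bounded lattices and $h_i:L_i\to M_i$ a bounded lattice morphism. Let $h=\bigoplus_{i=1}^nh_i:\bigoplus_{i=1}^nL_i\to\bigoplus_{i=1}^nM_i$. Then: (i) $h$ is Max-admissible iff $h_1,\ldots,h_n$ are all Max-admissible; (ii) $h$ is admissible iff $h_1,\ldots,h_n$ are all admissible.
   Context: Lattices are non-empty. $\mathrm{Con}(L)$ is the lattice of congruences of $L$ ordered by inclusion, with greatest element $\nabla_L=L^2$. $\mathrm{Max}(L)$ is the set of maximal elements of $\mathrm{Con}(L)\setminus\{\nabla_L\}$. Since the commutator of congruences of a lattice is the intersection, a congruence $\phi\neq\nabla_L$ is prime iff, for all $\alpha,\beta\in \mathrm{Con}(L)$, $\alpha\cap\beta\subseteq\phi$ implies $\alpha\subseteq\phi$ or $\beta\subseteq\phi$; $\mathrm{Spec}(L)$ is the set of prime congruences of $L$. For a bounded lattice morphism $h:L\to M$ (preserving $0$ and $1$) and $\psi\in \mathrm{Con}(M)$, $h^*(\psi)=\{(a,b)\in L^2 : (h(a),h(b))\in\psi\}\in \mathrm{Con}(L)$; $h$ is admissible if $h^*(\psi)\in \mathrm{Spec}(L)$ for all $\psi\in \mathrm{Spec}(M)$, and Max-admissible if $h^*(\psi)\in \mathrm{Max}(L)$ for all $\psi\in \mathrm{Max}(M)$. The ordinal sum $L\oplus L'$ of bounded lattices is obtained by putting $L'$ above $L$ and identifying the greatest element of $L$ with the least element of $L'$.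 For bounded lattice morphisms $h:L\to M$ and $h':L'\to M'$, $h\oplus h':L\oplus L'\to M\oplus M'$ is the bounded lattice morphism equal to $h$ on $L$ and to $h'$ on $L'$. Finite ordinal sums are obtained by iterating. *)

(* Defs.v *)
From HB Require Import structures.
From mathcomp Require Import all_boot all_order.
From mathcomp Require Import boolp classical_sets.

Set Implicit Arguments.
Unset Strict Implicit.
Unset Printing Implicit Defensive.

Import Order.Theory.

Local Open Scope order_scope.

(* [{tblmorphism L -> M}] only records the preservation of [\bot] and [\top],
   hence the join with [Order.LatticeMorphism]. *)
#[short(type="bddLatticeMorphism")]
HB.structure Definition BddLatticeMorphism d (L : tbLatticeType d)
    d' (M : tbLatticeType d') :=
  {f of @Order.LatticeMorphism d L d' M f & @Order.TBLatticeMorphism d L d' M f}.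

Section Congruences.
Variables (d : Order.disp_t) (L : tbLatticeType d).

Record is_congruence (theta : set (L * L)) : Prop := IsCongruence {
  congr_refl : forall x, theta (x, x);
  congr_sym : forall x y, theta (x, y) -> theta (y, x);
  congr_trans : forall x y z, theta (x, y) -> theta (y, z) -> theta (x, z);
  congr_meet : forall x y x' y', theta (x, y) -> theta (x', y') ->
    theta (x `&` x', y `&` y');
  congr_join : forall x y x' y', theta (x, y) -> theta (x', y') ->
    theta (x `|` x', y `|` y')
}.

Definition Con : set (set (L * L)) := [set theta | is_congruence theta]%classic.

Definition MaxCon : set (set (L * L)) :=
  [set phi | (Con `\ setT) phi /\
    forall psi, (Con `\ setT) psi -> phi `<=` psi -> psi = phi]%classic.

Definition Spec : set (set (L * L)) :=
  [set phi | (Con `\ setT) phi /\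
    forall alpha beta, Con alpha -> Con beta ->
      alpha `&` beta `<=` phi -> alpha `<=` phi \/ beta `<=` phi]%classic.

End Congruences.

Section Admissibility.
Variables (d d' : Order.disp_t) (L : tbLatticeType d) (M : tbLatticeType d').
Variable h : bddLatticeMorphism L M.

Definition congr_pullback (psi : set (M * M)) : set (L * L) :=
  [set ab | psi (h ab.1, h ab.2)]%classic.

Lemma congr_pullbackP psi : Con psi -> Con (congr_pullback psi).
Proof.
case=> r s t m j; split; rewrite /congr_pullback /=.
- by move=> x; exact: r.
- by move=> x y; exact: s.
- by move=> x y z; exact: t.
- by move=> x y x' y' xy xy'; rewrite !omorphI; exact: m.
- by move=> x y x' y' xy xy'; rewrite !omorphU; exact: j.
Qed.

Definition admissible : Prop :=
  forall psi, Spec psi -> Spec (congr_pullback psi).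

Definition Max_admissible : Prop :=
  forall psi, MaxCon psi -> MaxCon (congr_pullback psi).

End Admissibility.

(* The element [\top] of [L], identified with [\bot] of [L'], is represented
   in the left summand, so that the right summand only holds the elements of
   [L'] other than [\bot]. *)
Definition osum d d' (L : tbLatticeType d) (L' : tbLatticeType d') : Type :=
  (L + {y : L' | y != \bot})%type.

Section OrdinalSum.
Variables (d d' : Order.disp_t) (L : tbLatticeType d) (L' : tbLatticeType d').

Notation S := (osum L L').

HB.instance Definition _ := Choice.copy S (L + {y : L' | y != \bot})%type.

Definition osuml (x : L) : S := inl x.

Definition osumr (y : L') : S :=
  if insub y is Some u then inr u else inl \top.

Definition osum_le (s t : S) : bool :=
  match s, t with
  | inl x, inl x' => x <= x'
  | inl _, inr _ => true
  | inr _, inl _ => false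
  | inr y, inr y' => val y <= val y'
  end.

Definition osum_meet (s t : S) : S :=
  match s, t with
  | inl x, inl x' => osuml (x `&` x')
  | inl x, inr _ => osuml x
  | inr _, inl x' => osuml x'
  | inr y, inr y' => osumr (val y `&` val y')
  end.

Definition osum_join (s t : S) : S :=
  match s, t with
  | inl x, inl x' => osuml (x `|` x')
  | inl _, inr y' => inr y'
  | inr y, inl _ => inr y
  | inr y, inr y' => osumr (val y `|` val y')
  end.

Lemma osumr0 : osumr \bot = osuml \top.
Proof. by rewrite /osumr insubN // eqxx. Qed.

Lemma osumr_val (y : {y : L' | y != \bot}) : osumr (val y) = inr y.
Proof. by rewrite /osumr valK. Qed.

Lemma osumrE y (y0 : y != \bot) : osumr y = inr (exist _ y y0).
Proof. exact: (osumr_val (exist _ y y0)). Qed.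

Fact osum_le_refl : reflexive osum_le.
Proof. by case=> x /=; rewrite lexx. Qed.

Fact osum_le_anti : antisymmetric osum_le.
Proof.
move=> [x|x] [y|y] //= /le_anti; first by move->.
by move/val_inj->.
Qed.

Fact osum_le_trans : transitive osum_le.
Proof. by move=> [y|y] [x|x] [z|z] //=; exact: le_trans. Qed.

HB.instance Definition _ := Order.Le_isPOrder.Build d S
  osum_le_refl osum_le_anti osum_le_trans.

Lemma le_osumll x x' : (osuml x <= osuml x') = (x <= x').
Proof. by []. Qed.

Lemma le_osumlr x y : osuml x <= osumr y.
Proof.
rewrite /osumr; case: insubP => [//|_].
by change (x <= \top); rewrite lex1.
Qed.

Lemma le_osumrr y y' : (osumr y <= osumr y') = (y <= y').
Proof.
have [->|y0] := eqVneq y \bot; first by rewrite osumr0 le_osumlr le0x.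
rewrite (osumrE y0).
have [->|y'0] := eqVneq y' \bot.
  by rewrite osumr0 lex0 (negbTE y0).
by rewrite (osumrE y'0).
Qed.

Lemma osumP (s : S) : (exists x, s = osuml x) \/ (exists y, s = osumr y).
Proof.
by case: s => [x|y]; [left; exists x|right; exists (val y); rewrite osumr_val].
Qed.

Fact osum_meetP (s t u : S) : (s <= osum_meet t u) = (s <= t) && (s <= u).
Proof.
case: s t u => [x|x] [y|y] [z|z] //=; rewrite -?[inl _]/(osuml _).
- by rewrite !le_osumll lexI.
- by rewrite andbT.
- by rewrite le_osumlr.
- by rewrite andbF.
- by rewrite -!osumr_val !le_osumrr lexI.
Qed.

Fact osum_joinP (s t u : S) : (osum_join s t <= u) = (s <= u) && (t <= u).
Proof.
case: s t u => [x|x] [y|y] [z|z] //=; rewrite -?[inl _]/(osuml _).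
- by rewrite !le_osumll leUx.
- by rewrite andbF.
- by rewrite andbT.
- have xy0 : val x `|` val y != \bot.
    apply: contraNneq (valP x) => xy.
    by have := leUl (val x) (val y); rewrite xy lex0.
  by rewrite (osumrE xy0).
- by rewrite -!osumr_val !le_osumrr leUx.
Qed.

HB.instance Definition _ := Order.POrder_MeetJoin_isLattice.Build d S
  osum_meetP osum_joinP.

Fact osum_le0 (s : S) : osuml \bot <= s.
Proof. by case: s => [x|//]; rewrite -[inl _]/(osuml _) le_osumll le0x. Qed.

Fact osum_le1 (s : S) : s <= osumr \top.
Proof. by have [[x ->]|[y ->]] := osumP s; rewrite ?le_osumlr// le_osumrr lex1. Qed.

HB.instance Definition _ := Order.hasBottom.Build d S osum_le0.
HB.instance Definition _ := Order.hasTop.Build d S osum_le1.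

Lemma osumlI x x' : osuml x `&` osuml x' = osuml (x `&` x').
Proof. by []. Qed.

Lemma osumlU x x' : osuml x `|` osuml x' = osuml (x `|` x').
Proof. by []. Qed.

Lemma osumlrI x y : osuml x `&` osumr y = osuml x.
Proof. by apply/meet_idPl; exact: le_osumlr. Qed.

Lemma osumlrU x y : osuml x `|` osumr y = osumr y.
Proof. by apply/join_r; exact: le_osumlr. Qed.

Lemma osumrI y y' : osumr y `&` osumr y' = osumr (y `&` y').
Proof.
apply/le_anti; rewrite lexI !le_osumrr leIl leIr andbT.
have [[x E]|[z E]] := osumP (osumr y `&` osumr y'); first by rewrite E le_osumlr.
by rewrite E le_osumrr lexI -!le_osumrr -E leIl leIr.
Qed.

Lemma osumrU y y' : osumr y `|` osumr y' = osumr (y `|` y').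
Proof.
apply/le_anti; rewrite leUx !le_osumrr leUl leUr /=.
have [[x E]|[z E]] := osumP (osumr y `|` osumr y'); last first.
  by rewrite E le_osumrr leUx -!le_osumrr -E leUl leUr.
have le0 w : osumr w <= osuml x -> w = \bot.
  move=> wx; apply/eqP; rewrite -lex0 -le_osumrr osumr0.
  by apply: le_trans wx _; rewrite le_osumll lex1.
have y0 : y = \bot by apply: le0; rewrite -E leUl.
have y'0 : y' = \bot by apply: le0; rewrite -E leUr.
by rewrite y0 y'0 joinxx leUl.
Qed.

End OrdinalSum.

Arguments osuml {d d' L L'} x.
Arguments osumr {d d' L L'} y.
Arguments osumrE {d d' L L' y} y0.

Section OrdinalSumMap.
Variables (d1 d2 e1 e2 : Order.disp_t).
Variables (L : tbLatticeType d1) (L' : tbLatticeType d2).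
Variables (M : tbLatticeType e1) (M' : tbLatticeType e2).
Variables (h : bddLatticeMorphism L M) (h' : bddLatticeMorphism L' M').

Definition osum_map (s : osum L L') : osum M M' :=
  match s with
  | inl x => osuml (h x)
  | inr y => osumr (h' (val y))
  end.

Lemma osum_mapl x : osum_map (osuml x) = osuml (h x).
Proof. by []. Qed.

Lemma osum_mapr y : osum_map (osumr y) = osumr (h' y).
Proof.
have [->|y0] := eqVneq y \bot; first by rewrite osumr0 /= !(omorph0, omorph1) osumr0.
by rewrite (osumrE y0).
Qed.

Fact osum_map_meet : Order.meet_morphism osum_map.
Proof.
move=> s t; have [[x ->]|[y ->]] := osumP s; have [[x' ->]|[y' ->]] := osumP t.
- by rewrite osumlI !osum_mapl omorphI.
- by rewrite osumlrI osum_mapl osum_mapr osumlrI.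
- by rewrite meetC osumlrI osum_mapl osum_mapr meetC osumlrI.
- by rewrite osumrI !osum_mapr omorphI osumrI.
Qed.

Fact osum_map_join : Order.join_morphism osum_map.
Proof.
move=> s t; have [[x ->]|[y ->]] := osumP s; have [[x' ->]|[y' ->]] := osumP t.
- by rewrite osumlU !osum_mapl omorphU.
- by rewrite osumlrU osum_mapl osum_mapr osumlrU.
- by rewrite joinC osumlrU osum_mapl osum_mapr joinC osumlrU.
- by rewrite osumrU !osum_mapr omorphU osumrU.
Qed.

Fact osum_map_le : {homo osum_map : s t / s <= t}.
Proof. by move=> s t /meet_idPl st; apply/meet_idPl; rewrite -osum_map_meet st. Qed.

Fact osum_map0 : osum_map \bot = \bot.
Proof. by rewrite -[LHS]/(osuml (h \bot)) omorph0. Qed.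

Fact osum_map1 : osum_map \top = \top.
Proof. by rewrite -[\top in LHS]/(osumr \top) osum_mapr omorph1. Qed.

HB.instance Definition _ :=
  Order.isOrderMorphism.Build _ _ _ _ osum_map osum_map_le.
HB.instance Definition _ :=
  Order.isLatticeMorphism.Build _ _ _ _ osum_map osum_map_meet osum_map_join.
HB.instance Definition _ :=
  Order.isBLatticeMorphism.Build _ _ _ _ osum_map osum_map0.
HB.instance Definition _ :=
  Order.isTLatticeMorphism.Build _ _ _ _ osum_map osum_map1.

End OrdinalSumMap.

Fixpoint bigosum (n : nat) :
    forall d : 'I_n.+1 -> Order.disp_t,
    (forall i, tbLatticeType (d i)) -> tbLatticeType (d ord0) :=
  match n with
  | 0 => fun d L => L ord0
  | n'.+1 => fun d L => osum (L ord0) (bigosum (fun i => L (lift ord0 i)))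
  end.

Fixpoint bigosum_map (n : nat) :
    forall (d e : 'I_n.+1 -> Order.disp_t)
      (L : forall i, tbLatticeType (d i)) (M : forall i, tbLatticeType (e i)),
    (forall i, bddLatticeMorphism (L i) (M i)) ->
    bddLatticeMorphism (bigosum L) (bigosum M) :=
  match n with
  | 0 => fun d e L M h => h ord0
  | n'.+1 => fun d e L M h =>
      osum_map (h ord0) (bigosum_map (fun i => h (lift ord0 i)))
  end.

(* Main.v *)
Require Import Defs.
From mathcomp Require Import all_boot all_order.
From mathcomp Require Import boolp classical_sets.

(* Write c for the glueing point of L (+) L'. The maps s |-> s /\ c and
   s |-> s \/ c retract L (+) L' onto L and L', and every congruence, being
   compatible with them, is the intersection of the pullbacks of its two
   restrictions. Hence a prime (or maximal) congruence of L (+) L' is the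
   pullback of a prime (or maximal) congruence along one of the two
   retractions. As the retractions commute with h (+) h', the admissibility of
   h (+) h' reduces to that of h and of h'; then induct on n. *)

Set Implicit Arguments.
Unset Strict Implicit.
Unset Printing Implicit Defensive.

Import Order.Theory.

Local Open Scope classical_set_scope.
Local Open Scope order_scope.

(* Unlike [congr_pullback], this also applies to [osuml] and [osumr], which do
   not preserve both bounds. *)
Definition pull (S T : Type) (f : S -> T) (theta : set (T * T)) : set (S * S) :=
  [set st | theta (f st.1, f st.2)].

Lemma Con_pull d d' (S : tbLatticeType d) (T : tbLatticeType d')
    (f : S -> T) (theta : set (T * T)) :
  Order.meet_morphism f -> Order.join_morphism f ->
  Con theta -> Con (pull f theta).
Proof.
move=> fI fU [r s t m j]; split; rewrite /pull /=.
- by move=> x; exact: r.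
- by move=> x y; exact: s.
- by move=> x y z; exact: t.
- by move=> x y x' y' xy xy'; rewrite !fI; exact: m.
- by move=> x y x' y' xy xy'; rewrite !fU; exact: j.
Qed.

(** * Congruences along a lattice retraction *)

Section Retract.
Variables (d d' : Order.disp_t) (S : tbLatticeType d) (L : tbLatticeType d').
Variables (r : S -> L) (i : L -> S).
Hypotheses (rI : Order.meet_morphism r) (rU : Order.join_morphism r).
Hypotheses (iI : Order.meet_morphism i) (iU : Order.join_morphism i).
Hypothesis iK : cancel i r.
(** In the ordinal sum this holds because [i (r s)] is the meet or the join of [s] with a fixed
    element, an operation that every congruence respects. *)
Hypothesis sub_pull_retract :
  forall theta, Con theta -> theta `<=` pull r (pull i theta).

Lemma pull_retractK (phi : set (L * L)) : pull i (pull r phi) = phi.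
Proof. by apply/seteqP; split=> -[x y]; rewrite /pull /= !iK. Qed.

Lemma Con_pull_retract (phi : set (L * L)) : Con (pull r phi) <-> Con phi.
Proof.
split=> [|]; last exact: Con_pull.
by move=> /(Con_pull iI iU); rewrite pull_retractK.
Qed.

Lemma proper_pull_retract (phi : set (L * L)) :
  (@Con _ S `\ setT)%classic (pull r phi) <-> (@Con _ L `\ setT)%classic phi.
Proof.
split=> -[/Con_pull_retract Cphi nT]; split=> // phiT; apply: nT => /=.
  by rewrite phiT.
by rewrite -[LHS]pull_retractK phiT.
Qed.

(** Since [phi] is reflexive, [psi] contains the kernel of [r]. It therefore identifies [s] with
    [i (r s)], and is determined by its restriction along [i]. *)
Lemma pull_restrict_ker (phi : set (L * L)) (psi : set (S * S)) :
  Con phi -> Con psi -> pull r phi `<=` psi ->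
  pull r (pull i psi) = psi.
Proof.
move=> Cphi Cpsi phipsi; apply/seteqP; split; last exact: sub_pull_retract.
have ker s : psi (s, i (r s)).
  by apply: phipsi; rewrite /pull /= iK; exact: congr_refl.
move=> [s t] /= st; apply: (congr_trans Cpsi (ker s)).
by apply: (congr_trans Cpsi st); apply: congr_sym.
Qed.

(** By [pull_restrict_ker], everything above [pull r phi] is again a pullback along [r], so the
    proper congruences above [phi] and above [pull r phi] correspond. *)
Lemma MaxCon_pull_retract (phi : set (L * L)) : MaxCon (pull r phi) <-> MaxCon phi.
Proof.
split=> -[/proper_pull_retract Pphi maxphi]; split=> // psi Ppsi phipsi.
  rewrite -[LHS]pull_retractK -[RHS]pull_retractK; congr pull.
  by apply: maxphi; [exact/proper_pull_retract | move=> st; exact: phipsi].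
have E := pull_restrict_ker ((Con_pull_retract _).1 Pphi.1) Ppsi.1 phipsi.
rewrite -E; congr pull; apply: maxphi.
  by apply/proper_pull_retract; rewrite E.
by rewrite -[X in X `<=` _]pull_retractK => xy; exact: phipsi.
Qed.

Lemma Spec_pull_retract (phi : set (L * L)) : Spec (pull r phi) <-> Spec phi.
Proof.
split=> -[/proper_pull_retract Pphi primephi]; split=> // alpha beta Ca Cb ab.
  have [|||ab'|ab'] := primephi (pull r alpha) (pull r beta).
  - exact/Con_pull_retract.
  - exact/Con_pull_retract.
  - by move=> st; exact: ab.
  - by left; rewrite -(pull_retractK alpha) -(pull_retractK phi) => xy; exact: ab'.
  - by right; rewrite -(pull_retractK beta) -(pull_retractK phi) => xy; exact: ab'.
(* Arbitrary congruences of [S] may be replaced by their restrictions along [i], since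
   [sub_pull_retract] recovers an upper bound for each of them. *)
have [|||ab'|ab'] := primephi (pull i alpha) (pull i beta).
- exact: Con_pull.
- exact: Con_pull.
- by rewrite -(pull_retractK phi) => xy; exact: ab.
- by left=> st /(sub_pull_retract Ca); exact: ab'.
- by right=> st /(sub_pull_retract Cb); exact: ab'.
Qed.

End Retract.

(** * Prime and maximal congruences of an ordinal sum *)

Section OrdinalSumCongruences.
Variables (d d' : Order.disp_t) (L : tbLatticeType d) (L' : tbLatticeType d').
Notation S := (osum L L').

Definition retractl (s : S) : L := if s is inl x then x else \top.
Definition retractr (s : S) : L' := if s is inr y then val y else \bot.

Lemma osumlK : cancel osuml retractl. Proof. by []. Qed.

Lemma osumrK : cancel osumr retractr.
Proof.
move=> y; have [->|y0] := eqVneq y \bot; first by rewrite osumr0.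
by rewrite (osumrE y0).
Qed.

Lemma retractl_osumr y : retractl (osumr y) = \top.
Proof. by rewrite /osumr; case: insubP. Qed.

Lemma osuml_retract s : osuml (retractl s) = s `&` osuml \top.
Proof.
have [[x ->]|[y ->]] := osumP s; first by rewrite osumlI meetx1.
by rewrite retractl_osumr meetC osumlrI.
Qed.

Lemma osumr_retract s : osumr (retractr s) = s `|` osumr \bot.
Proof.
have [[x ->]|[y ->]] := osumP s; first by rewrite osumlrU.
by rewrite osumrK osumrU joinx0.
Qed.

Lemma retractl_meet : Order.meet_morphism retractl.
Proof.
move=> s t; have [[x ->]|[y ->]] := osumP s; have [[x' ->]|[y' ->]] := osumP t.
- by rewrite osumlI.
- by rewrite osumlrI retractl_osumr meetx1.
- by rewrite meetC osumlrI retractl_osumr meet1x.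
- by rewrite osumrI !retractl_osumr meetxx.
Qed.

Lemma retractl_join : Order.join_morphism retractl.
Proof.
move=> s t; have [[x ->]|[y ->]] := osumP s; have [[x' ->]|[y' ->]] := osumP t.
- by rewrite osumlU.
- by rewrite osumlrU retractl_osumr joinx1.
- by rewrite joinC osumlrU retractl_osumr join1x.
- by rewrite osumrU !retractl_osumr joinxx.
Qed.

Lemma retractr_meet : Order.meet_morphism retractr.
Proof.
move=> s t; have [[x ->]|[y ->]] := osumP s; have [[x' ->]|[y' ->]] := osumP t.
- by rewrite osumlI /= meetxx.
- by rewrite osumlrI /= meet0x.
- by rewrite meetC osumlrI /= meetx0.
- by rewrite osumrI !osumrK.
Qed.

Lemma retractr_join : Order.join_morphism retractr.
Proof.
move=> s t; have [[x ->]|[y ->]] := osumP s; have [[x' ->]|[y' ->]] := osumP t.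
- by rewrite osumlU /= joinxx.
- by rewrite osumlrU /= join0x.
- by rewrite joinC osumlrU /= joinx0.
- by rewrite osumrU !osumrK.
Qed.

Lemma osuml_meet : Order.meet_morphism (@osuml _ _ L L').
Proof. by move=> x y; rewrite osumlI. Qed.

Lemma osuml_join : Order.join_morphism (@osuml _ _ L L').
Proof. by move=> x y; rewrite osumlU. Qed.

Lemma osumr_meet : Order.meet_morphism (@osumr _ _ L L').
Proof. by move=> x y; rewrite osumrI. Qed.

Lemma osumr_join : Order.join_morphism (@osumr _ _ L L').
Proof. by move=> x y; rewrite osumrU. Qed.

Lemma sub_pull_retractl (theta : set (S * S)) : Con theta ->
  theta `<=` pull retractl (pull osuml theta).
Proof.
move=> C [s t] st; rewrite /pull /= !osuml_retract.
by apply: congr_meet => //; exact: congr_refl.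
Qed.

Lemma sub_pull_retractr (theta : set (S * S)) : Con theta ->
  theta `<=` pull retractr (pull osumr theta).
Proof.
move=> C [s t] st; rewrite /pull /= !osumr_retract.
by apply: congr_join => //; exact: congr_refl.
Qed.

(** For [s] and [t] in the same summand, one of the two memberships is already the claim. In
    different summands, each relates one of them to the glueing point, and transitivity
    concludes. *)
Lemma pull_retractI (theta : set (S * S)) : Con theta ->
  (pull retractl (pull osuml theta) `&` pull retractr (pull osumr theta)
    `<=` theta)%classic.
Proof.
move=> C [s t]; rewrite /pull /=.
have [[x ->]|[y ->]] := osumP s; have [[x' ->]|[y' ->]] := osumP t => -[];
  rewrite ?retractl_osumr ?osumrK //= osumr0 => p q;
  [exact: (congr_trans C p q) | exact: (congr_trans C q p)].
Qed.

Lemma Spec_osum (psi : set (S * S)) : Spec psi ->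
  pull retractl (pull osuml psi) = psi \/ pull retractr (pull osumr psi) = psi.
Proof.
(* Primeness puts one of the two pullbacks below [psi]; both lie above it. *)
move=> [[C _] prime]; have [||H|H] := prime _ _ _ _ (pull_retractI C).
- apply: (Con_pull retractl_meet retractl_join).
  exact: (Con_pull osuml_meet osuml_join).
- apply: (Con_pull retractr_meet retractr_join).
  exact: (Con_pull osumr_meet osumr_join).
- by left; apply/seteqP; split=> //; exact: sub_pull_retractl.
- by right; apply/seteqP; split=> //; exact: sub_pull_retractr.
Qed.

Lemma MaxCon_osum (psi : set (S * S)) : MaxCon psi ->
  pull retractl (pull osuml psi) = psi \/ pull retractr (pull osumr psi) = psi.
Proof.
move=> [[C nT] maxpsi].
(* Both pullbacks contain [psi], so by maximality each is [psi] or total. Both cannot be total, as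
   their intersection lies in [psi]. *)
have [lT|lT] := pselect (pull retractl (pull osuml psi) = setT); last first.
  left; apply: maxpsi (sub_pull_retractl C); split=> //.
  apply: (Con_pull retractl_meet retractl_join).
  exact: (Con_pull osuml_meet osuml_join).
right; apply: maxpsi (sub_pull_retractr C); split.
  apply: (Con_pull retractr_meet retractr_join).
  exact: (Con_pull osumr_meet osumr_join).
move=> /= rT; apply: nT; apply/seteqP; split=> // st _.
by apply: (pull_retractI C); rewrite lT rT.
Qed.

Lemma Spec_pull_retractl (phi : set (L * L)) :
  Spec (pull retractl phi) <-> Spec phi.
Proof.
exact: (Spec_pull_retract retractl_meet retractl_join osuml_meet osuml_join
  osumlK sub_pull_retractl).
Qed.

Lemma Spec_pull_retractr (phi : set (L' * L')) :
  Spec (pull retractr phi) <-> Spec phi.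
Proof.
exact: (Spec_pull_retract retractr_meet retractr_join osumr_meet osumr_join
  osumrK sub_pull_retractr).
Qed.

Lemma MaxCon_pull_retractl (phi : set (L * L)) :
  MaxCon (pull retractl phi) <-> MaxCon phi.
Proof.
exact: (MaxCon_pull_retract retractl_meet retractl_join osuml_meet osuml_join
  osumlK sub_pull_retractl).
Qed.

Lemma MaxCon_pull_retractr (phi : set (L' * L')) :
  MaxCon (pull retractr phi) <-> MaxCon phi.
Proof.
exact: (MaxCon_pull_retract retractr_meet retractr_join osumr_meet osumr_join
  osumrK sub_pull_retractr).
Qed.

End OrdinalSumCongruences.

Arguments retractl {d d' L L'} s.
Arguments retractr {d d' L L'} s.

(** * Admissibility of the sum of two morphisms *)

Section OrdinalSumAdmissible.
Variables (d1 d2 e1 e2 : Order.disp_t).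
Variables (L : tbLatticeType d1) (L' : tbLatticeType d2).
Variables (M : tbLatticeType e1) (M' : tbLatticeType e2).
Variables (h : bddLatticeMorphism L M) (h' : bddLatticeMorphism L' M').

(** Preservation of bounds enters here: [retractl] sends the upper summand to [\top], which [h]
    preserves. Dually, [retractr_osum_map] uses that [h'] preserves [\bot]. *)
Lemma retractl_osum_map s : retractl (osum_map h h' s) = h (retractl s).
Proof.
have [[x ->]|[y ->]] := osumP s; first by rewrite osum_mapl.
by rewrite osum_mapr !retractl_osumr omorph1.
Qed.

Lemma retractr_osum_map s : retractr (osum_map h h' s) = h' (retractr s).
Proof.
have [[x ->]|[y ->]] := osumP s; first by rewrite osum_mapl /= omorph0.
by rewrite osum_mapr !osumrK.
Qed.

Lemma congr_pullback_retractl (phi : set (M * M)) :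
  congr_pullback (osum_map h h') (pull retractl phi)
  = pull retractl (congr_pullback h phi).
Proof.
by apply/seteqP; split=> -[s t];
  rewrite /congr_pullback /pull /= !retractl_osum_map.
Qed.

Lemma congr_pullback_retractr (phi : set (M' * M')) :
  congr_pullback (osum_map h h') (pull retractr phi)
  = pull retractr (congr_pullback h' phi).
Proof.
by apply/seteqP; split=> -[s t];
  rewrite /congr_pullback /pull /= !retractr_osum_map.
Qed.

Lemma admissible_osum_map :
  admissible (osum_map h h') <-> admissible h /\ admissible h'.
Proof.
split=> [A|[A A'] psi Ppsi].
  (* A prime of either codomain is lifted to the sum along its retraction, pulled back there, and
     brought down again. *)
  split=> phi.
    move/(Spec_pull_retractl M')/A; rewrite congr_pullback_retractl.
    by move/Spec_pull_retractl.
  move/(Spec_pull_retractr M)/A; rewrite congr_pullback_retractr.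
  by move/Spec_pull_retractr.
(* A prime of the sum comes from one summand, which decides whether [A] or [A'] applies. *)
have [E|E] := Spec_osum Ppsi; move: Ppsi; rewrite -E.
  move/Spec_pull_retractl/A; rewrite congr_pullback_retractl.
  by move/Spec_pull_retractl.
move/Spec_pull_retractr/A'; rewrite congr_pullback_retractr.
by move/Spec_pull_retractr.
Qed.

Lemma Max_admissible_osum_map :
  Max_admissible (osum_map h h') <-> Max_admissible h /\ Max_admissible h'.
Proof.
split=> [A|[A A'] psi Ppsi].
  split=> phi.
    move/(MaxCon_pull_retractl M')/A; rewrite congr_pullback_retractl.
    by move/MaxCon_pull_retractl.
  move/(MaxCon_pull_retractr M)/A; rewrite congr_pullback_retractr.
  by move/MaxCon_pull_retractr.
have [E|E] := MaxCon_osum Ppsi; move: Ppsi; rewrite -E.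
  move/MaxCon_pull_retractl/A; rewrite congr_pullback_retractl.
  by move/MaxCon_pull_retractl.
move/MaxCon_pull_retractr/A'; rewrite congr_pullback_retractr.
by move/MaxCon_pull_retractr.
Qed.

End OrdinalSumAdmissible.

(** * Induction on the number of summands *)

Lemma forall_ord1 (P : 'I_1 -> Prop) : (forall i, P i) <-> P ord0.
Proof. by split=> // P0 i; rewrite ord1. Qed.

Lemma forall_ord_recl n (P : 'I_n.+1 -> Prop) :
  (forall i, P i) <-> P ord0 /\ forall i, P (lift ord0 i).
Proof.
split=> [H|[P0 PS] i]; first by split.
by case: (unliftP ord0 i) => [j ->|->].
Qed.

Theorem corollary5p10 (n : nat) (d e : 'I_n.+1 -> Order.disp_t)
    (L : forall i, tbLatticeType (d i)) (M : forall i, tbLatticeType (e i))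
    (h : forall i, bddLatticeMorphism (L i) (M i)) :
  (Max_admissible (bigosum_map h) <-> forall i, Max_admissible (h i)) /\
  (admissible (bigosum_map h) <-> forall i, admissible (h i)).
Proof.
(* There are [n.+1] summands, so in the base case [bigosum_map h] is [h ord0] itself. The types vary
   with the index, hence the generalization over all data. *)
elim: n d e L M h => [|n IHn] d e L M h; first by rewrite !forall_ord1.
have [IHmax IHadm] := IHn _ _ _ _ (fun i => h (lift ord0 i)).
split; rewrite forall_ord_recl.
  by rewrite -IHmax; exact: Max_admissible_osum_map.
by rewrite -IHadm; exact: admissible_osum_map.
Qed.
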